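(* Let $K,L_1,L_2$ be finite unital rings such that $\varTheta(K)\cong\varTheta(L_1)\times\varTheta(L_2)$. Then $K=K_1\times K_2$ for some subrings $K_1,K_2\subseteq K$ with $\varTheta(K_1)\cong\varTheta(L_1)$ and $\varTheta(K_2)\cong\varTheta(L_2)$.
   Context: For a finite unital ring $R$, define $a\sim b$ if and only if $a=bu=vb$ for some units $u,v\in R$; this is an equivalence relation, and $[a]$ denotes the class of $a$. $\varTheta(R)$ is the directed graph whose vertices are the classes $[a]$, $a\in R$, with a directed edge $[x]\to[y]$ ($[x]$, $[y]$ not necessarily distinct) if and only if $xy=0$ (this is well defined). The product of directed graphs is the tensor product: $G\times H$ has vertex set $V(G)\times V(H)$ and an edge $(g,h)\to(g',h')$ if and only if there are edges $g\to g'$ in $G$ and $h\to h'$ in $H$. Isomorphisms are isomorphisms of directed graphs. The equality $K=K_1\times K_2$ denotes an internal direct product of rings; the subrings $K_1,K_2$ need not contain the identity of $K$ but are unital rings with their own identity elements (the zero ring is allowed). *)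

(* Defs.v *)
From HB Require Import structures.
From mathcomp Require Import all_boot all_order all_algebra.

Set Implicit Arguments.
Unset Strict Implicit.
Unset Printing Implicit Defensive.

Import GRing.Theory.
Local Open Scope ring_scope.

Record digraph := Digraph { vertex :> finType; edge : rel vertex }.

Definition digraph_iso (G H : digraph) : Prop :=
  exists f : G -> H, bijective f /\ forall x y, edge (f x) (f y) = edge x y.

Definition tensor_edge (G H : digraph) : rel (G * H) :=
  fun p q => edge p.1 q.1 && edge p.2 q.2.

Definition tensor_digraph (G H : digraph) : digraph :=
  Digraph (@tensor_edge G H).

(* [finPzRingType]: finite unital rings, not necessarily commutative, with
   1 = 0 allowed. [GRing.unit] is not available here since [unitRingType]
   excludes the zero ring. *)
Section Theta.
Variable R : finPzRingType.
Implicit Types a b c x y u v : R.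

Definition is_unit u := [exists v, (u * v == 1) && (v * u == 1)].

Definition assoc : rel R := fun a b =>
  [exists u, exists v, [&& is_unit u, is_unit v, a == b * u & a == v * b]].

Lemma is_unitP u : reflect (exists v, u * v = 1 /\ v * u = 1) (is_unit u).
Proof.
apply: (iffP existsP) => [[v /andP[/eqP h /eqP h']]|[v [h h']]]; exists v => //.
by rewrite h h' !eqxx.
Qed.

Lemma is_unit1 : is_unit 1.
Proof. by apply/is_unitP; exists 1; rewrite mulr1. Qed.

Lemma is_unitM u v : is_unit u -> is_unit v -> is_unit (u * v).
Proof.
move=> /is_unitP[u' [uu' u'u]] /is_unitP[v' [vv' v'v]].
apply/is_unitP; exists (v' * u'); split.
  by rewrite mulrA -(mulrA u) vv' mulr1.
by rewrite mulrA -(mulrA v') u'u mulr1.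
Qed.

Lemma assocP a b :
  reflect (exists u v, [/\ is_unit u, is_unit v, a = b * u & a = v * b])
          (assoc a b).
Proof.
apply: (iffP existsP) => [[u /existsP[v /and4P[? ? /eqP ? /eqP ?]]]|].
  by exists u, v.
move=> [u [v [hu hv au av]]]; exists u; apply/existsP; exists v.
by rewrite hu hv -au -av eqxx.
Qed.

Lemma assoc_refl : reflexive assoc.
Proof.
by move=> a; apply/assocP; exists 1, 1; rewrite mulr1 mul1r; split;
  rewrite ?is_unit1.
Qed.

Lemma assoc_sym : symmetric assoc.
Proof.
suff h a b : assoc a b -> assoc b a by move=> a b; apply/idP/idP; apply: h.
move=> /assocP[u [v [/is_unitP[u' [uu' u'u]] /is_unitP[v' [vv' v'v]] au av]]].
apply/assocP; exists u', v'; split.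
- by apply/is_unitP; exists u.
- by apply/is_unitP; exists v.
- by rewrite au -mulrA uu' mulr1.
- by rewrite av mulrA v'v mul1r.
Qed.

Lemma assoc_trans : transitive assoc.
Proof.
move=> b a c /assocP[u [v [hu hv au av]]] /assocP[w [z [hw hz bw bz]]].
apply/assocP; exists (w * u), (v * z); split; rewrite ?is_unitM //.
  by rewrite au bw mulrA.
by rewrite av bz mulrA.
Qed.

Lemma assoc_equivalence : {in [set: R] & &, equivalence_rel assoc}.
Proof.
move=> a b c _ _ _; split=> [|ab]; first exact: assoc_refl.
apply/idP/idP => h; last exact: assoc_trans h.
by apply: assoc_trans h; rewrite assoc_sym.
Qed.

Definition theta_vertex :=
  {C : {set R} | C \in equivalence_partition assoc [set: R]}.

(* By [theta_edgeE], this does not depend on the representatives chosen. *)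
Definition theta_edge : rel theta_vertex := fun C D =>
  [exists x in val C, exists y in val D, x * y == 0].

Definition theta : digraph := Digraph theta_edge.

Fact theta_class_subproof a :
  [set b in [set: R] | assoc a b] \in equivalence_partition assoc [set: R].
Proof. by apply/imsetP; exists a. Qed.

Definition theta_class a : theta :=
  exist (fun C : {set R} => C \in equivalence_partition assoc [set: R])
    _ (theta_class_subproof a).

Lemma theta_classP (C : theta) : exists a, C = theta_class a.
Proof. by case: C => C CP; case/imsetP: (CP) => a _ Ca; exists a; apply: val_inj. Qed.

Lemma theta_class_eq a b : (theta_class a == theta_class b) = assoc a b.
Proof.
apply/eqP/idP => [/(congr1 val)/setP/(_ b)|ab].
  by rewrite !inE /= assoc_refl.
apply/val_inj/setP => c; rewrite !inE /=.
by have [_ ->] := assoc_equivalence (in_setT a) (in_setT b) (in_setT c).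
Qed.

Lemma theta_edgeE x y : edge (theta_class x) (theta_class y) = (x * y == 0).
Proof.
apply/existsP/eqP => [[x' /andP[]]|xy0]; last first.
  exists x; rewrite !inE assoc_refl /=; apply/existsP; exists y.
  by rewrite !inE assoc_refl xy0 eqxx.
rewrite !inE /= => /assocP[_ [v [_ _ _ xv]]] /existsP[y' /andP[]].
rewrite !inE /= => /assocP[u [_ [_ _ yu _]]] /eqP xy0.
by rewrite xv yu mulrA -(mulrA v) xy0 mulr0 mul0r.
Qed.

End Theta.

(* A unital subring of [K] has its own identity [subring_one], which may differ
   from the identity of [K]. *)
Record unital_subring (K : finPzRingType) := UnitalSubring {
  subring_set :> {set K};
  subring_one : K;
  subring_zmod_closed : zmod_closed subring_set;
  subring_mul_closed : GRing.mulr_2closed subring_set;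
  subring_one_mem : subring_one \in subring_set;
  subring_mul1r : {in subring_set, left_id subring_one *%R};
  subring_mulr1 : {in subring_set, right_id subring_one *%R}
}.

Section SubringType.
Variables (K : finPzRingType) (S : unital_subring K).

Definition subring_pred : {pred K} := [in subring_set S].

HB.instance Definition _ :=
  GRing.isZmodClosed.Build K subring_pred (subring_zmod_closed S).

Record subring_type := SubringElt {
  subring_val : K;
  subring_valP : subring_val \in subring_pred
}.

HB.instance Definition _ := [isSub for subring_val].
HB.instance Definition _ := [Finite of subring_type by <:].
HB.instance Definition _ := [SubChoice_isSubZmodule of subring_type by <:].

Definition subring_type_one : subring_type :=
  SubringElt (subring_one_mem S).

Definition subring_type_mul (x y : subring_type) : subring_type :=
  SubringElt (subring_mul_closed (subring_valP x) (subring_valP y)).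

Fact subring_type_mulA : associative subring_type_mul.
Proof. by move=> x y z; apply: val_inj; apply: mulrA. Qed.

Fact subring_type_mul1r : left_id subring_type_one subring_type_mul.
Proof. by move=> x; apply: val_inj; apply: subring_mul1r (subring_valP x). Qed.

Fact subring_type_mulr1 : right_id subring_type_one subring_type_mul.
Proof. by move=> x; apply: val_inj; apply: subring_mulr1 (subring_valP x). Qed.

Fact subring_type_mulDl : left_distributive subring_type_mul +%R.
Proof. by move=> x y z; apply: val_inj; apply: mulrDl. Qed.

Fact subring_type_mulDr : right_distributive subring_type_mul +%R.
Proof. by move=> x y z; apply: val_inj; apply: mulrDr. Qed.

HB.instance Definition _ := GRing.Zmodule_isPzRing.Build subring_type
  subring_type_mulA subring_type_mul1r subring_type_mulr1
  subring_type_mulDl subring_type_mulDr.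

End SubringType.

Definition subring_ring (K : finPzRingType) (S : unital_subring K) :
  finPzRingType := subring_type S.

Definition internal_sum (K : finPzRingType) (K1 K2 : unital_subring K)
    (p : subring_ring K1 * subring_ring K2) : K :=
  subring_val p.1 + subring_val p.2.

(* K = K1 x K2: (x, y) |-> x + y is a ring isomorphism from the external
   product onto K. *)
Definition internal_direct_product (K : finPzRingType)
    (K1 K2 : unital_subring K) : Prop :=
  [/\ zmod_morphism (@internal_sum K K1 K2),
      monoid_morphism (@internal_sum K K1 K2) &
      bijective (@internal_sum K K1 K2)].

(* Main.v *)
(** Let [a], [b] in [K] represent the vertices corresponding to [([1], [0])]
   and [([0], [1])]. The graph shows that the left and right annihilators of
   [a] agree, likewise for [b], that [ab = ba = 0], and that the two ideals
   [A = ann a] and [B = ann b] satisfy [AB = BA = 0] and intersect trivially.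
   Since [ax] lies in [B] and [bx] in [A], an [x] with [(a + b) x = 0] lies in
   both ideals and vanishes; as [K] is finite, [a + b] is invertible. Hence
   [K = B x A], and the classes of the elements of [B] are exactly the vertices
   [(g, [0])], that is, a copy of [theta L1]; symmetrically for [A]. *)
Require Import Defs.
From mathcomp Require Import all_boot all_order all_algebra.

Set Implicit Arguments.
Unset Strict Implicit.
Unset Printing Implicit Defensive.

Import GRing.Theory.
Local Open Scope ring_scope.

Definition central_idempotent (K : finPzRingType) (e : K) : Prop :=
  e * e = e /\ forall x, e * x = x * e.

Lemma central_idempotentC (K : finPzRingType) (e : K) :
  central_idempotent e -> central_idempotent (1 - e).
Proof.
move=> [ee eC]; split=> [|x]; last by rewrite mulrBl mulrBr mul1r mulr1 eC.
by rewrite mulrBl mul1r mulrBr mulr1 ee subrr subr0.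
Qed.

Section Corner.
Variables (K : finPzRingType) (e : K) (he : central_idempotent e).

Definition corner_set : {set K} := [set x | e * x == x].

Fact corner_zmod_closed : zmod_closed corner_set.
Proof.
split=> [|x y]; first by rewrite inE mulr0.
by rewrite !inE mulrBr => /eqP-> /eqP->.
Qed.

Fact corner_mul_closed : GRing.mulr_2closed corner_set.
Proof. by move=> x y; rewrite !inE mulrA => /eqP->. Qed.

Fact corner_one_mem : e \in corner_set.
Proof. by rewrite inE he.1. Qed.

Fact corner_mul1r : {in corner_set, left_id e *%R}.
Proof. by move=> x; rewrite inE => /eqP. Qed.

Fact corner_mulr1 : {in corner_set, right_id e *%R}.
Proof. by move=> x; rewrite inE -he.2 => /eqP. Qed.

Definition corner : unital_subring K :=
  UnitalSubring corner_zmod_closed corner_mul_closed corner_one_mem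
    corner_mul1r corner_mulr1.

Fact corner_proj_subproof x : e * x \in subring_pred corner.
Proof. by rewrite inE mulrA he.1. Qed.

Definition corner_proj x : subring_ring corner :=
  SubringElt (corner_proj_subproof x).

Lemma cornerP (x : subring_ring corner) : e * val x = val x.
Proof. by apply/eqP; have := subring_valP x; rewrite inE. Qed.

Lemma corner_proj_unit u : is_unit u -> is_unit (corner_proj u).
Proof.
have [ee eC] := he.
have proj1 x y : x * y = 1 -> corner_proj x * corner_proj y = 1.
  move=> xy; apply: val_inj => /=.
  by rewrite -mulrA (mulrA x) -(eC x) -mulrA xy mulr1 ee.
move=> /is_unitP[v [uv vu]]; apply/is_unitP; exists (corner_proj v).
by split; apply: proj1.
Qed.

Lemma corner_unit_ext (u : subring_ring corner) :
  is_unit u -> is_unit (val u + (1 - e)).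
Proof.
have [ee eC] := he; have [cc cC] := central_idempotentC he.
have c0 (x : subring_ring corner) : (1 - e) * val x = 0.
  by rewrite mulrBl mul1r cornerP subrr.
have ext1 (x y : subring_ring corner) :
    x * y = 1 -> (val x + (1 - e)) * (val y + (1 - e)) = 1.
  move=> /(congr1 val)/= xy.
  rewrite mulrDl (mulrDr (val x)) (mulrDr (1 - e)) -(cC (val x)) !c0 cc xy.
  by rewrite addr0 add0r addrC subrK.
move=> /is_unitP[v [uv vu]]; apply/is_unitP; exists (val v + (1 - e)).
by split; apply: ext1.
Qed.

Lemma corner_assoc (x y : subring_ring corner) :
  assoc (val x) (val y) = assoc x y.
Proof.
have [ee eC] := he.
apply/assocP/assocP => -[u [v [hu hv xu xv]]].
  exists (corner_proj u), (corner_proj v).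
  split; rewrite ?corner_proj_unit //; apply: val_inj => /=.
    by rewrite mulrA -eC cornerP.
  by rewrite eC -mulrA cornerP.
have c0 (z : subring_ring corner) : (1 - e) * val z = 0.
  by rewrite mulrBl mul1r cornerP subrr.
exists (val u + (1 - e)), (val v + (1 - e)).
split; rewrite ?corner_unit_ext //.
  by rewrite mulrDr -(central_idempotentC he).2 c0 addr0 xu.
by rewrite mulrDl c0 addr0 xv.
Qed.

(* The second hypothesis says that the image of [i] consists of the classes of
   the elements of the corner. *)
Lemma corner_theta_iso (G : digraph) (i : G -> theta K) (p : theta K -> G) :
    cancel i p ->
    (forall x, (i (p (theta_class x)) == theta_class x) = (e * x == x)) ->
    (forall g h, edge (i g) (i h) = edge g h) ->
  digraph_iso (theta (subring_ring corner)) G.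
Proof.
move=> ipK imi iedge.
have rep (R : finPzRingType) (C : theta R) : {x : R | C == theta_class x}.
  by apply: sigW; have [x ->] := theta_classP C; exists x.
pose r (C : theta (subring_ring corner)) := sval (rep _ C).
have rE C : theta_class (r C) = C by apply/esym/eqP; exact: svalP (rep _ C).
pose f C := p (theta_class (val (r C))).
have ifE C : i (f C) = theta_class (val (r C)).
  by apply/eqP; rewrite imi cornerP.
exists f; split; last first.
  by move=> C D; rewrite -iedge !ifE -{2}(rE C) -{2}(rE D) !theta_edgeE.
exists (fun g => theta_class (corner_proj (sval (rep _ (i g))))) => [C|g].
  apply/eqP; rewrite -[in X in _ == X](rE C) theta_class_eq -corner_assoc.
  case: (rep _ (i (f C))) => x /= /eqP; rewrite ifE => /esym/eqP xC.
  have /eqP -> : e * x == x by rewrite -imi (eqP xC) imi cornerP.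
  by rewrite -theta_class_eq.
apply: (can_inj ipK); rewrite ifE.
set x := sval _; have /eqP igx : i g == theta_class x := svalP (rep _ (i g)).
have /eqP ex : e * x == x by rewrite -imi -igx ipK.
have := rE (theta_class (corner_proj x)); move/eqP.
by rewrite theta_class_eq -corner_assoc /= ex igx -theta_class_eq => /eqP.
Qed.

End Corner.

Lemma corner_direct_product (K : finPzRingType) (e : K)
    (he : central_idempotent e) (he' : central_idempotent (1 - e)) :
  internal_direct_product (corner he) (corner he').
Proof.
have [ee eC] := he.
have c0 (x : subring_ring (corner he)) : (1 - e) * val x = 0.
  by rewrite mulrBl mul1r cornerP subrr.
have e0 (x : subring_ring (corner he')) : e * val x = 0.
  by rewrite -(cornerP x) mulrA mulrBr mulr1 ee subrr mul0r.
split.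
- by move=> [x1 x2] [y1 y2]; rewrite /internal_sum /= opprD addrACA.
- split; first by rewrite /internal_sum /= addrC subrK.
  move=> [x1 x2] [y1 y2]; rewrite /internal_sum /=.
  have x12 : val x1 * val y2 = 0.
    by rewrite -(cornerP x1) eC -mulrA e0 mulr0.
  have x21 : val x2 * val y1 = 0.
    by rewrite -(cornerP x2) he'.2 -mulrA c0 mulr0.
  by rewrite mulrDl !mulrDr x12 x21 addr0 add0r.
exists (fun x => (corner_proj he x, corner_proj he' x)) => [[x y]|x].
  congr pair; apply: val_inj; rewrite /= /internal_sum /= mulrDr.
    by rewrite cornerP e0 addr0.
  by rewrite c0 cornerP add0r.
by rewrite /internal_sum /= -mulrDl addrC subrK mul1r.
Qed.

Lemma annihilator_idempotent (K : finPzRingType) (a b : K) :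
    (forall x, (a * x == 0) = (x * a == 0)) ->
    (forall x, (b * x == 0) = (x * b == 0)) ->
    a * b = 0 ->
    (forall x y, a * x = 0 -> b * y = 0 -> x * y = 0 /\ y * x = 0) ->
    (forall x, a * x = 0 -> b * x = 0 -> x = 0) ->
  exists2 e : K, central_idempotent e &
    forall x, (e * x == x) = (b * x == 0) /\ (e * x == 0) = (a * x == 0).
Proof.
move=> annA annB ab AB0 capAB.
have ba : b * a = 0 by apply/eqP; rewrite -annA ab.
have inj_ab : injective ( *%R (a + b)).
  move=> x y /eqP; rewrite -subr_eq0 -mulrBr => /eqP; set z := x - y => abz.
  suff z0 : z = 0 by apply/eqP; rewrite -subr_eq0 -/z z0.
  have bz : b * z = 0.
    apply: capAB; first by rewrite mulrA ab mul0r.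
    have := congr1 ( *%R b) abz.
    by rewrite mulrDl mulrDr !mulrA ba mul0r add0r mulr0.
  by apply: capAB => //; move: abz; rewrite mulrDl bz addr0.
have [g _ gK] := injF_bij inj_ab.
have := gK 1; set u := g 1; rewrite mulrDl.
set e := a * u; set f := b * u => ef1.
have be : b * e = 0 by rewrite /e mulrA ba mul0r.
have af : a * f = 0 by rewrite /f mulrA ab mul0r.
have eB x : b * x = 0 -> e * x = x.
  by move=> bx; rewrite -[RHS]mul1r -ef1 mulrDl (AB0 _ _ af bx).1 addr0.
have eA x : a * x = 0 -> e * x = 0 by move=> ax; rewrite (AB0 _ _ ax be).2.
exists e.
  split=> [|x]; first exact: eB.
  have bex : b * (e * x) = 0 by rewrite mulrA be mul0r.
  have bxe : b * (x * e) = 0.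
    apply/eqP; rewrite annB -mulrA; have /eqP -> : e * b == 0.
      by rewrite -annB be.
    by rewrite mulr0.
  have exf := (AB0 _ _ af bex).2.
  by rewrite -(eB _ bxe) mulrA -[LHS]mulr1 -ef1 mulrDr exf addr0.
move=> x; split; apply/eqP/eqP => [ex|].
- by rewrite -ex mulrA be mul0r.
- exact: eB.
- by rewrite -[x]mul1r -ef1 mulrDl ex add0r mulrA af mul0r.
- exact: eA.
Qed.

Lemma theta_edge0l (R : finPzRingType) (C : theta R) : edge (theta_class 0) C.
Proof. by have [x ->] := theta_classP C; rewrite theta_edgeE mul0r. Qed.

Lemma theta_edge0r (R : finPzRingType) (C : theta R) : edge C (theta_class 0).
Proof. by have [x ->] := theta_classP C; rewrite theta_edgeE mulr0. Qed.

Lemma theta_class_eq0 (R : finPzRingType) (x : R) :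
  (theta_class x == theta_class 0) = (x == 0).
Proof.
rewrite theta_class_eq; apply/idP/eqP => [/assocP[u [_ [_ _ -> _]]]|->].
  by rewrite mul0r.
exact: assoc_refl.
Qed.

Lemma theta_edge1l (R : finPzRingType) (C : theta R) :
  edge (theta_class 1) C = (C == theta_class 0).
Proof.
by have [x ->] := theta_classP C; rewrite theta_edgeE mul1r theta_class_eq0.
Qed.

Lemma theta_edge1r (R : finPzRingType) (C : theta R) :
  edge C (theta_class 1) = (C == theta_class 0).
Proof.
by have [x ->] := theta_classP C; rewrite theta_edgeE mulr1 theta_class_eq0.
Qed.

Theorem proposition2p9 (K L1 L2 : finPzRingType) :
  digraph_iso (theta K) (tensor_digraph (theta L1) (theta L2)) ->
  exists K1 K2 : unital_subring K,
    [/\ internal_direct_product K1 K2,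
        digraph_iso (theta (subring_ring K1)) (theta L1) &
        digraph_iso (theta (subring_ring K2)) (theta L2)].
Proof.
move=> [phi [[psi phiK psiK] phi_edge]].
have [a aE] := theta_classP (psi (theta_class 1, theta_class 0)).
have [b bE] := theta_classP (psi (theta_class 0, theta_class 1)).
pose q x := phi (theta_class x).
have q_inj x y : q x = q y -> theta_class x = theta_class y.
  exact: (can_inj phiK).
have qa : q a = (theta_class 1, theta_class 0) by rewrite /q -aE psiK.
have qb : q b = (theta_class 0, theta_class 1) by rewrite /q -bE psiK.
have mulE x y : (x * y == 0) = edge (q x).1 (q y).1 && edge (q x).2 (q y).2.
  by rewrite -theta_edgeE -phi_edge.
have amul x : (a * x == 0) = ((q x).1 == theta_class 0).
  by rewrite mulE qa theta_edge1l theta_edge0l andbT.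
have mula x : (x * a == 0) = ((q x).1 == theta_class 0).
  by rewrite mulE qa theta_edge1r theta_edge0r andbT.
have bmul x : (b * x == 0) = ((q x).2 == theta_class 0).
  by rewrite mulE qb theta_edge1l theta_edge0l.
have mulb x : (x * b == 0) = ((q x).2 == theta_class 0).
  by rewrite mulE qb theta_edge1r theta_edge0r.
have [|||||e he eE] := @annihilator_idempotent K a b.
- by move=> x; rewrite amul mula.
- by move=> x; rewrite bmul mulb.
- by apply/eqP; rewrite amul qb.
- move=> x y /eqP; rewrite amul => /eqP x0 /eqP; rewrite bmul => /eqP y0.
  by split; apply/eqP; rewrite mulE x0 y0 ?theta_edge0l ?theta_edge0r.
- move=> x /eqP; rewrite amul => /eqP x1 /eqP; rewrite bmul => /eqP x2.
  by apply/eqP; rewrite -[x]mulr1 mulE x1 x2 !theta_edge0l.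
have psi_edge p p' :
    edge (psi p) (psi p') = edge p.1 p'.1 && edge p.2 p'.2.
  by rewrite -phi_edge !psiK.
exists (corner he), (corner (central_idempotentC he)); split.
- exact: corner_direct_product.
- apply: (@corner_theta_iso _ _ _ _ (fun g => psi (g, theta_class 0))
                                    (fun C => (phi C).1)) => [g|x|g h].
  + by rewrite psiK.
  + rewrite (eE x).1 bmul /q -(inj_eq (can_inj phiK)) psiK.
    by case: (phi _) => u v /=; rewrite xpair_eqE eqxx eq_sym.
  + by rewrite psi_edge theta_edge0l andbT.
- apply: (@corner_theta_iso _ _ _ _ (fun g => psi (theta_class 0, g))
                                    (fun C => (phi C).2)) => [g|x|g h].
  + by rewrite psiK.
  + rewrite mulrBl mul1r -[X in _ = (_ == X)]subr0 (inj_eq (addrI x)).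
    rewrite eqr_opp (eE x).2 amul /q -(inj_eq (can_inj phiK)) psiK.
    by case: (phi _) => u v /=; rewrite xpair_eqE eqxx andbT eq_sym.
  + by rewrite psi_edge theta_edge0l.
Qed.
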